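(* Let $n \geq 1$, let $0 < \underline{m} < 1 < \bar m$ and $\vartheta > 0$, and for every $t>1$ let $f_t$ be a $\vartheta$-self-concordant barrier over the interior of the feasible set $\mathcal P_t$ of the linear program $\mathrm{CEX}_n(t)$. Let $\mathcal{C}_t(\eta)$ ($\eta>0$) be the central path of $\mathrm{CEX}_n(t)$ associated with $f_t$. Then, for every constant $\kappa > 0$, there exists $t_0 > 1$ such that for all $t \geq t_0$ the following holds: if $[x^0,x^1] \cup [x^1,x^2] \cup \dots \cup [x^{p-1},x^p]$ is a sequence of segments (the trajectory of an interior point method performing $p$ iterations) which is contained in the multiplicative neighborhood $\mathcal{M}_{\underline m,\bar m,t}(\mathbb{R}_{>0})$ of the central path, and which reduces the value of the objective function from $x^0_n \geq \kappa$ to $x^p_n \leq 1/t^{2u_n}$, then $p \geq 2^n - 1$.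
   Context: Set $u_k := 3\cdot 2^{k-2} - 1$ for $k \geq 1$. For a real parameter $t>1$, the linear program $\mathrm{CEX}_n(t)$ is: minimize $x_n$ over the set $\mathcal P_t$ of points $x \in \mathbb{R}^n$ satisfying $$t^{-u_i} \Big(\sum_{j = 1}^{i-1} x_j\Big) + t^{-u_{i+1} + 1} x_i \leq \sum_{j = i+1}^{n-1} t^{-u_j} x_j + x_n + t^{-u_n} \quad (i = 1, \dots, n-1),$$ $$\sum_{j = 1}^n x_j \leq 1, \qquad 0 \leq x_1 \leq x_2 \leq \dots \leq x_{n-1} \leq t^{u_n} x_n .$$ Self-concordant barriers: let $f$ be a $C^2$ real-valued function on an open convex set $D_f \subset \mathbb{R}^n$, with gradient $g(x)$ and positive definite Hessian $H(x)$. Put $\|v\|_x := \sqrt{v^\top H(x) v}$ and $B_x(y,r) := \{z \in \mathbb{R}^n : \|y-z\|_x < r\}$. The function $f$ is (strongly nondegenerate) self-concordant if for all $x \in D_f$ we have $B_x(x,1) \subset D_f$ and, for all $y \in B_x(x,1)$ and $v \neq 0$, $1-\|y-x\|_x \leq \|v\|_y/\|v\|_x \leq 1/(1-\|y-x\|_x)$. It is a $\vartheta$-self-concordant barrier over $D_f$ if moreover $\sup_{x \in D_f} \|H(x)^{-1}g(x)\|_x^2 \leq \vartheta$. Central path: for $\eta>0$, $\mathcal{C}_t(\eta)$ is the unique minimizer of $\eta x_n + f_t(x)$ over $x$ in the interior of $\mathcal P_t$. Multiplicative neighborhood: $\mathcal{M}_{\underline m,\bar m,t}(\eta) := \{x \in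 \mathcal P_t : \underline m\, \mathcal{C}_t(\eta) \leq x \leq \bar m\, \mathcal{C}_t(\eta)\}$ (entrywise inequalities), and $\mathcal{M}_{\underline m,\bar m,t}(\mathbb{R}_{>0}) := \bigcup_{\eta>0} \mathcal{M}_{\underline m,\bar m,t}(\eta)$. *)

(* Defs.v *)
From HB Require Import structures.
From mathcomp Require Export all_boot all_order all_algebra.
From mathcomp Require Export all_classical all_reals all_analysis.

Set Implicit Arguments.
Unset Strict Implicit.
Unset Printing Implicit Defensive.

Export Order.TTheory GRing.Theory Num.Theory.
Export numFieldNormedType.Exports.

Local Open Scope classical_set_scope.
Local Open Scope ring_scope.

Section LinearProgram.
Context {R : realType}.

(* Points of R^n are row vectors.  [coord x k] is the k-th coordinate counted
   from 1; it is meant for 1 <= k <= n only. *)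
Definition coord {n : nat} (x : 'rV[R]_n) (k : nat) : R :=
  if insub k.-1 is Some i then x 0 (i : 'I_n) else 0.

(* The exponent k - 2 is an integer: u 1 = 1/2. *)
Definition u (k : nat) : R := 3 * 2 ^ (k%:Z - 2) - 1.

(* In the chain 0 <= x_1 <= ... <= x_(n-1) <= t^(u_n) x_n the last term is not
   x_n itself; for n = 1 the chain reads 0 <= t^(u_1) x_1. *)
Definition cex_feasible (n : nat) (t : R) : set 'rV[R]_n :=
  [set x | [/\
    forall i, (1 <= i < n)%N ->
      t `^ (- u i) * (\sum_(1 <= j < i) coord x j)
        + t `^ (- u i.+1 + 1) * coord x i
      <= (\sum_(i.+1 <= j < n) t `^ (- u j) * coord x j)
        + coord x n + t `^ (- u n),
    \sum_(1 <= j < n.+1) coord x j <= 1 &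
    sorted <=%R (0 :: rcons [seq coord x j | j <- index_iota 1 n]
                            (t `^ u n * coord x n))]].

End LinearProgram.

Arguments cex_feasible {R} n t _.

Section SelfConcordance.
Context {R : realType} {n : nat}.
Implicit Types (f : 'rV[R]_n -> R) (D : set 'rV[R]_n) (x y v : 'rV[R]_n).

Definition gradient f x : 'rV[R]_n := \row_i 'D_(delta_mx 0 i) f x.

Definition hessian f x : 'M[R]_n := 'J (gradient f) x.

(* Only used with [D] open. *)
Definition C2_on D f : Prop := forall x, D x ->
  [/\ differentiable f x, differentiable (gradient f) x &
      {for x, continuous (hessian f)}].

(* Symmetry is not required: it is automatic for the Hessian of a C^2
   function. *)
Definition posdefmx (A : 'M[R]_n) : Prop :=
  forall v, v != 0 -> 0 < (v *m A *m v^T) 0 0.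

Definition local_norm f x v : R :=
  Num.sqrt ((v *m hessian f x *m v^T) 0 0).

Definition local_ball f x y (r : R) : set 'rV[R]_n :=
  [set z | local_norm f x (y - z) < r].

Definition self_concordant D f : Prop :=
  [/\ [/\ open D, convex_set D, C2_on D f &
          forall x, D x -> posdefmx (hessian f x)],
      forall x, D x -> local_ball f x x 1 `<=` D &
      forall x, D x -> forall y, local_ball f x x 1 y -> forall v, v != 0 ->
        1 - local_norm f x (y - x) <= local_norm f y v / local_norm f x v
          <= 1 / (1 - local_norm f x (y - x))].

(* For row vectors, H^-1 g is g *m H^-1 because H is symmetric. *)
Definition newton f x : 'rV[R]_n := gradient f x *m invmx (hessian f x).

Definition self_concordant_barrier (theta : R) D f : Prop :=
  self_concordant D f /\
  (ereal_sup [set ((local_norm f x (newton f x)) ^+ 2)%:E | x in D]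
    <= theta%:E)%E.

End SelfConcordance.

Section CentralPath.
Context {R : realType} {n : nat}.
Implicit Types (f : 'rV[R]_n -> R) (t eta ml mu : R) (x c : 'rV[R]_n).

Definition is_central_point f t eta c : Prop :=
  (cex_feasible n t)° c /\
  forall x, (cex_feasible n t)° x -> x != c ->
    eta * coord c n + f c < eta * coord x n + f x.

(* The default value 0 is returned only if there is no such point, which does
   not happen for t > 1, eta > 0 and f a self-concordant barrier over the
   interior of the (compact) feasible set. *)
Definition central_path f t eta : 'rV[R]_n :=
  xget 0 [set c | is_central_point f t eta c].

Definition mult_nbhd ml mu f t eta : set 'rV[R]_n :=
  [set x | cex_feasible n t x /\
     forall i, ml * central_path f t eta 0 i <= x 0 i
                 <= mu * central_path f t eta 0 i].

Definition mult_nbhd_path ml mu f t : set 'rV[R]_n :=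
  \bigcup_(eta in [set e | 0 < e]) mult_nbhd ml mu f t eta.

Definition segment (a b : 'rV[R]_n) : set 'rV[R]_n :=
  [set (1 - s) *: a + s *: b | s in `[0, 1]].

End CentralPath.

(* Main.v *)
(** A central point c is at bounded distance, in its own local norm, from every
    feasible y with y_n <= c_n, because the barrier has a nonnegative slope at c
    in the direction y - c; as the unit local ball of c is feasible, each y_i is
    at most a constant times c_i.  Hence, up to factors independent of t, the
    central point has as i-th entry the largest x_i under the constraint
    x_n <= c_n.  On the log_t scale this turns the central path into a piecewise
    linear curve: while log_t x_n goes from 0 to - 2 u_n, there are 2^n - 2
    values - k, with k = 3 q + e and e in {0, 1}, at which some coordinate,
    read off the binary digits of q, starts to decrease after having been
    constant.  A segment whose last coordinate crosses t^(-k) strictly in the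
    log scale carries this coordinate below the lower bound valid at t^(-k): at
    the crossing point the weight of its upper end is about t^(-1/2).  So the
    trajectory has a vertex close to each of these values, hence at least
    2^n - 1 segments. *)

Require Import Defs.
From mathcomp Require Import ring lra zify.

Set Implicit Arguments.
Unset Strict Implicit.
Unset Printing Implicit Defensive.

Local Open Scope classical_set_scope.
Local Open Scope ring_scope.

(** * Self-concordant barriers *)

Section Barrier.
Context {R : realType} {n : nat}.
Implicit Types (f : 'rV[R]_n -> R) (D : set 'rV[R]_n) (x y v w z : 'rV[R]_n).

Lemma is_derive_line (W : normedModType R) (g : 'rV[R]_n -> W) x v s dg :
  is_derive (x + s *: v) v g dg ->
  is_derive s 1 (fun r : R => g (x + r *: v)) dg.
Proof.
have E : (fun h : R => h^-1 *: (((fun r : R => g (x + r *: v)) \o shift s) (h *: 1)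
            - g (x + s *: v))) =
         (fun h => h^-1 *: ((g \o shift (x + s *: v)) (h *: v) - g (x + s *: v))).
  apply/funext => h /=; congr (_ *: (g _ - _)).
  by rewrite [h *: 1](mulr1) scalerDl addrCA.
by move=> [dg1 dg2]; split; rewrite /derivable /derive E.
Qed.

Lemma is_derive_MVT (h dh : R -> R) (a b : R) : a <= b ->
  (forall s, a <= s <= b -> is_derive s 1 h (dh s)) ->
  exists2 s, a <= s <= b & h b - h a = dh s * (b - a).
Proof.
move=> ab dhP.
have dvc (s : R) : s \in `[a, b] -> is_derive s 1 h (dh s).
  by rewrite in_itv /=; exact: dhP.
have dvo (s : R) : s \in `]a, b[ -> is_derive s 1 h (dh s).
  by move=> sab; apply: dvc; exact: subset_itv_oo_cc sab.
have ch : {within `[a, b], continuous h}.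
  by apply: derivable_within_continuous => s /dvc [].
have [s sab E] := MVT_segment ab dvo ch.
by exists s => //; move: sab; rewrite in_itv.
Qed.

Lemma line_MVT (g dg : 'rV[R]_n -> R) x v :
  (forall s : R, 0 <= s <= 1 -> is_derive (x + s *: v) v g (dg (x + s *: v))) ->
  exists2 s : R, 0 <= s <= 1 & g (x + v) - g x = dg (x + s *: v).
Proof.
move=> dgP.
have drv (s : R) : 0 <= s <= 1 ->
    is_derive s 1 (fun r : R => g (x + r *: v)) (dg (x + s *: v)).
  by move=> /dgP; exact: is_derive_line.
have [s s01] := is_derive_MVT ler01 drv.
by rewrite scale1r scale0r addr0 subr0 mulr1 => E; exists s.
Qed.

Lemma derive_gradient f x w : differentiable f x ->
  is_derive x w f ((gradient f x *m w^T) 0 0).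
Proof.
move=> df; split; first exact: diff_derivable.
rewrite deriveE// {1}(row_sum_delta w) linear_sum mxE; apply: eq_bigr => i _.
by rewrite linearZ /= !mxE deriveE// mulrC.
Qed.

Lemma derive_hessian f x v w : differentiable (gradient f) x ->
  is_derive x v (fun z => (gradient f z *m w^T) 0 0)
    ((v *m hessian f x *m w^T) 0 0).
Proof.
move=> dg.
have dc i : is_derive x v (fun z => gradient f z 0 i) ((v *m hessian f x) 0 i).
  have dgv : derivable (gradient f) x v by exact: diff_derivable.
  split; first by have /derivable_mxP := dgv.
  by rewrite -deriveEjacobian // derive_mx // mxE.
have -> : (fun z => (gradient f z *m w^T) 0 0) =
    \sum_i (fun z => w 0 i *: gradient f z 0 i).
  by apply/funext => z; rewrite fct_sumE mxE; apply: eq_bigr => i _;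
    rewrite [w^T _ _]mxE mulrC.
apply: is_derive_eq; rewrite mxE; apply: eq_bigr => i _.
by rewrite [w^T _ _]mxE mulrC.
Qed.

(** The left-hand side is symmetric in [v] and [w], whence Schwarz's theorem. *)
Lemma line_hessian f D x v w : open D -> C2_on D f ->
  (forall s r : R, 0 <= s <= 1 -> 0 <= r <= 1 -> D (x + s *: v + r *: w)) ->
  exists2 s, 0 <= s <= 1 & exists2 r, 0 <= r <= 1 &
    f (x + v + w) - f (x + v) - (f (x + w) - f x) =
    (w *m hessian f (x + s *: v + r *: w) *m v^T) 0 0.
Proof.
move=> oD C2 Dx.
pose g z := f (z + w) - f z.
pose dg z := (gradient f (z + w) *m v^T) 0 0 - (gradient f z *m v^T) 0 0.
have Dg s : 0 <= s <= 1 -> is_derive (x + s *: v) v g (dg (x + s *: v)).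
  move=> s01.
  have D0 : D (x + s *: v).
    by have := Dx s 0 s01; rewrite scale0r addr0; apply; rewrite lexx ler01.
  have D1 : D (x + s *: v + w).
    by have := Dx s 1 s01; rewrite scale1r; apply; rewrite lexx ler01.
  apply: is_deriveB; last by apply: derive_gradient; have [] := C2 _ D0.
  have : is_derive (x + s *: v + w) v f ((gradient f (x + s *: v + w) *m v^T) 0 0).
    by apply: derive_gradient; have [] := C2 _ D1.
  have E : (fun h : R => h^-1 *: (((fun z => f (z + w)) \o shift (x + s *: v)) (h *: v)
            - f (x + s *: v + w))) =
         (fun h => h^-1 *: ((f \o shift (x + s *: v + w)) (h *: v) - f (x + s *: v + w))).
    by apply/funext => h /=; rewrite !addrA.
  by move=> [d1 d2]; split; rewrite /derivable /derive E.
have [s s01 Es] := line_MVT Dg.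
have Dh r : 0 <= r <= 1 -> is_derive (x + s *: v + r *: w) w
    (fun z => (gradient f z *m v^T) 0 0)
    ((w *m hessian f (x + s *: v + r *: w) *m v^T) 0 0).
  by move=> r01; apply: derive_hessian; have [] := C2 _ (Dx s r s01 r01).
have [r r01 Er] := line_MVT (dg := fun z => (w *m hessian f z *m v^T) 0 0) Dh.
exists s => //; exists r => //.
by rewrite -Er -[RHS]/(dg (x + s *: v)) -Es.
Qed.

Lemma delta_bilin (A : 'M[R]_n) i j (e : R) :
  ((e *: delta_mx 0 i : 'rV[R]_n) *m A *m (e *: delta_mx 0 j : 'rV[R]_n)^T) 0 0
  = e ^+ 2 * A i j.
Proof.
by rewrite linearZ /= -!scalemxAl -scalemxAr -rowE trmx_delta -colE !mxE mulrA expr2.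
Qed.

(** The second difference of [f] over a small square of side [a] is [a ^+ 2] times entry [(j, i)] of
    the Hessian at one nearby point, and [a ^+ 2] times entry [(i, j)] at another. Continuity of the
    Hessian at [x] then puts the two entries within any [d] of each other. *)
Lemma hessian_sym f D x : open D -> C2_on D f -> D x ->
  (hessian f x)^T = hessian f x.
Proof.
move=> oD C2 Dx; apply/matrixP => i j; rewrite mxE; apply/eqP.
rewrite -subr_eq0 -normr_le0; apply/ler_addgt0Pl => d d0; rewrite addr0.
have [_ _ cH] := C2 x Dx.
have cij k l : \forall z \near x, `|hessian f x k l - hessian f z k l| < d / 2.
  have : {for x, continuous ((fun M : 'M[R]_n => M k l) \o hessian f)}.
    by apply: continuous_comp; [exact: cH|exact: coord_continuous].
  by move/cvgrPdist_lt; apply; rewrite divr_gt0.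
have /nbhs_ballP[e e0 He] : \forall z \near x,
    [/\ D z, `|hessian f x i j - hessian f z i j| < d / 2 &
             `|hessian f x j i - hessian f z j i| < d / 2].
  near=> z; split; near: z; [exact: open_nbhs_nbhs|exact: cij..].
have [a a0 ae] : exists2 a : R, 0 < a & a + a < e.
  by move: (e0 : 0 < e) => e0'; exists (e / 4); [rewrite divr_gt0|lra].
have Ha k l s r : 0 <= s <= 1 -> 0 <= r <= 1 ->
    ball x e (x + s *: (a *: delta_mx 0 k) + r *: (a *: delta_mx 0 l)).
  move=> /andP[s0 s1] /andP[r0 r1].
  have nd i0 : `|(delta_mx 0 i0 : 'rV[R]_n)| <= 1.
    rewrite [leLHS]/Num.Def.normr/= mx_normrE bigmax_le // => -[i1 j1] _ /=.
    by rewrite mxE; case: andP; rewrite /= ?normr1 ?normr0.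
  have nsa b i0 : 0 <= b -> b <= 1 -> `|b *: (a *: delta_mx 0 i0 : 'rV[R]_n)| <= a.
    move=> b0 b1; rewrite scalerA normrZ ger0_norm ?mulr_ge0 ?(ltW a0) //.
    rewrite -[leRHS]mulr1.
    by apply: ler_pM; rewrite ?mulr_ge0 ?(ltW a0) ?ler_piMl ?(ltW a0) ?nd.
  rewrite mx_norm_ball /ball_ /= -addrA opprD addrA subrr add0r normrN.
  apply: le_lt_trans (ler_normD _ _) _.
  have := nsa s k s0 s1; have := nsa r l r0 r1; lra.
have HD k l s r : 0 <= s <= 1 -> 0 <= r <= 1 ->
    D (x + s *: (a *: delta_mx 0 k) + r *: (a *: delta_mx 0 l)).
  by move=> s01 r01; have [] := He _ (Ha k l s r s01 r01).
pose v k : 'rV[R]_n := a *: delta_mx 0 k.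
have [X H1 E1] : exists2 X, `|hessian f x j i - X| < d / 2 &
    f (x + v i + v j) - f (x + v i) - (f (x + v j) - f x) = a ^+ 2 * X.
  have [s sP [r rP E]] := line_hessian oD C2 (HD i j).
  by have [_ _ H] := He _ (Ha i j _ _ sP rP); eexists; [exact: H|rewrite E delta_bilin].
have [Y H2 E2] : exists2 Y, `|hessian f x i j - Y| < d / 2 &
    f (x + v j + v i) - f (x + v j) - (f (x + v i) - f x) = a ^+ 2 * Y.
  have [s sP [r rP E]] := line_hessian oD C2 (HD j i).
  by have [_ H _] := He _ (Ha j i _ _ sP rP); eexists; [exact: H|rewrite E delta_bilin].
have XY : X = Y.
  apply: (mulfI (x := a ^+ 2)); first by rewrite expf_neq0 // gt_eqF.
  by rewrite -E1 -E2 [in RHS](addrAC x); ring.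
subst Y; rewrite distrC in H2.
apply: le_trans (ler_distD X _ _) _.
by rewrite [leRHS]splitr lerD // ltW.
Unshelve. all: by end_near. Qed.

Lemma posdefmx_unit (A : 'M[R]_n) : posdefmx A -> A \in unitmx.
Proof.
move=> A0; rewrite -row_free_unit; apply: inj_row_free => v vA.
by apply/eqP; apply: contraT => /A0; rewrite vA mul0mx mxE ltxx.
Qed.

(** Cauchy-Schwarz, read off the nonnegative square of [c *: v - b *: w], where [b] is the product
    of [v] and [w] and [c] the square of [w]. *)
Lemma posdefmx_CS (A : 'M[R]_n) v w : A^T = A -> posdefmx A ->
  ((v *m A *m w^T) 0 0) ^+ 2 <= (v *m A *m v^T) 0 0 * (w *m A *m w^T) 0 0.
Proof.
move=> AT A0.
have qD (a1 a2 b : 'rV[R]_n) (s1 s2 : R) : ((s1 *: a1 + s2 *: a2) *m A *m b^T) 0 0 =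
    s1 * (a1 *m A *m b^T) 0 0 + s2 * (a2 *m A *m b^T) 0 0.
  by rewrite !mulmxDl -!scalemxAl !mxE.
have qC (a b : 'rV[R]_n) : (a *m A *m b^T) 0 0 = (b *m A *m a^T) 0 0.
  have -> : (a *m A *m b^T) 0 0 = ((a *m A *m b^T)^T) 0 0 by rewrite [RHS]mxE.
  by rewrite !trmx_mul AT trmxK mulmxA.
have [->|w0] := eqVneq w 0.
  by rewrite trmx0 mulmx0 !mul0mx !mxE expr0n mulr0.
set a := (v *m A *m v^T) 0 0; set b := (v *m A *m w^T) 0 0.
set c := (w *m A *m w^T) 0 0.
have c0 : 0 < c by exact: A0.
have : 0 <= ((c *: v + - b *: w) *m A *m (c *: v + - b *: w)^T) 0 0.
  have [->|/A0/ltW//] := eqVneq (c *: v + - b *: w) 0.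
  by rewrite !mul0mx mxE.
rewrite qD qC [X in _ + - b * X]qC !qD -/a -/c (qC w v) -/b.
have -> : c * (c * a + - b * b) + - b * (c * b + - b * c) = c * (a * c - b ^+ 2) by ring.
by rewrite pmulr_rge0 // subr_ge0.
Qed.

(** The gradient pairs with [v] as the Newton step does in the local inner product, so
    Cauchy-Schwarz applies and [theta] bounds the squared norm of the Newton step. *)
Lemma barrier_gradient theta D f x v : self_concordant_barrier theta D f -> D x ->
  ((gradient f x *m v^T) 0 0) ^+ 2 <= theta * (v *m hessian f x *m v^T) 0 0.
Proof.
move=> [[[oD _ C2 pd] _ _] sup] Dx.
have HT := hessian_sym oD C2 Dx; have H0 := pd x Dx.
have HU := posdefmx_unit H0.
have Hge0 w : 0 <= (w *m hessian f x *m w^T) 0 0.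
  by have [->|/H0/ltW//] := eqVneq w 0; rewrite !mul0mx mxE.
have gE : gradient f x = newton f x *m hessian f x by rewrite /newton mulmxKV.
rewrite [in leLHS]gE; apply: le_trans (posdefmx_CS _ _ HT H0) _.
apply: ler_wpM2r; first exact: Hge0.
rewrite -lee_fin; apply: le_trans sup.
rewrite -[X in X%:E]sqr_sqrtr ?Hge0 //.
by apply: ereal_sup_ubound; exists x.
Qed.

(** [psi' >= psi ^+ 2 / theta] makes [psi] blow up within time
    [theta / psi s0], which has to exceed [1 - s0]. *)
Lemma riccati_bound (psi N2 : R -> R) (theta N : R) : 0 < theta ->
  (forall s : R, 0 <= s < 1 -> is_derive s 1 psi (N2 s)) ->
  (forall s : R, 0 <= s < 1 -> psi s ^+ 2 <= theta * N2 s) ->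
  (forall s : R, 0 <= s < 1 -> s * N <= 1 / 2 -> N ^+ 2 / 4 <= N2 s) ->
  0 <= psi 0 -> N <= 1 + 16 * theta.
Proof.
move=> th0 dpsi bpsi NN2 psi0; rewrite leNgt; apply/negP => NB.
have N20 (s : R) : 0 <= s < 1 -> 0 <= N2 s.
  by move=> /bpsi; rewrite -ler_pdivrMl //; apply: le_trans;
    rewrite mulr_ge0 ?invr_ge0 ?sqr_ge0 // ltW.
(* Up to this time [s * N <= 1 / 2], so [psi] grows at rate at least [N ^+ 2 / 4] and reaches
   [N / 8]. *)
pose s0 := (2 * N)^-1.
have s0N : s0 * N = 1 / 2 by rewrite /s0; field; lra.
have s00 : 0 < s0 by rewrite invr_gt0; lra.
have s01 : s0 < 1 / 2 by rewrite -s0N -[ltLHS]mulr1 ltr_pM2l //; lra.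
have N2s (s : R) : 0 <= s <= s0 -> N ^+ 2 / 4 <= N2 s.
  move=> /andP[sge0 sles0]; apply: NN2; first by apply/andP; split; lra.
  by rewrite -s0N ler_wpM2r //; lra.
have psis0 : N / 8 <= psi s0.
  have [||s /andP[sge0 sle] E] := @is_derive_MVT psi N2 0 s0; first exact: ltW.
    by move=> s /andP[? ?]; apply: dpsi; apply/andP; split; lra.
  have := N2s s; rewrite sge0 sle => /(_ isT) N2s'.
  have : N ^+ 2 / 4 * s0 <= N2 s * (s0 - 0) by rewrite subr0 ler_wpM2r // ltW.
  rewrite -E (_ : N ^+ 2 / 4 * s0 = N / 4 * (s0 * N)); last by ring.
  by rewrite s0N; lra.
have psi_gt0 (s : R) : s0 <= s < 1 -> 0 < psi s.
  move=> /andP[ss s1].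
  have [||r /andP[r0 r1] E] := @is_derive_MVT psi N2 s0 s; first exact: ss.
    by move=> r /andP[? ?]; apply: dpsi; apply/andP; split; lra.
  have : 0 <= N2 r * (s - s0).
    by rewrite mulr_ge0 ?subr_ge0 // N20 //; apply/andP; split; lra.
  by rewrite -E; lra.
(* Nonincreasing while [psi] is positive, by the Riccati inequality. *)
pose chi (s : R) := (psi s)^-1 + s / theta.
pose dchi (s : R) := - (psi s) ^- 2 * N2 s + theta^-1.
have dchiP (s : R) : s0 <= s < 1 -> is_derive s 1 chi (dchi s).
  move=> s0s; have p0 := psi_gt0 s s0s.
  have /andP[ss s1] := s0s.
  have dp : is_derive s 1 psi (N2 s) by apply: dpsi; apply/andP; split; lra.
  have dV : is_derive s 1 (fun r => (psi r)^-1) (- (psi s) ^- 2 * N2 s).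
    have dp' : derivable psi s 1 by case: dp.
    have p1 : psi s != 0 by rewrite gt_eqF.
    split; first exact: derivableV.
    by rewrite deriveV // (@derive_val _ _ _ _ _ _ _ dp).
  apply: is_deriveD.
  have -> : (fun r : R => r / theta) = theta^-1 *: id.
    by apply/funext => r; rewrite /= mulrC.
  by apply: is_derive_eq; rewrite [LHS]mulr1.
have dchi0 (s : R) : s0 <= s < 1 -> dchi s <= 0.
  move=> s0s; have p0 := psi_gt0 s s0s.
  have /andP[ss s1] := s0s.
  have : psi s ^+ 2 <= theta * N2 s by apply: bpsi; apply/andP; split; lra.
  have p20 : 0 < psi s ^+ 2 by rewrite exprn_gt0.
  rewrite -ler_pdivrMl // mulrC => H.
  rewrite /dchi mulNr addrC subr_le0.
  by rewrite mulrC ler_pdivlMr // mulrC.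
(* From [s0] on, the inverse of [psi] starts at [8 / N] or less and falls at rate at least
   [1 / theta], so it would be at most 0 at [s1]. The assumption [1 + 16 * theta < N] places [s1]
   before 1. *)
pose s1 := s0 + 8 * theta / N.
have s1P : s0 <= s1 < 1.
  have : 8 * theta / N < 1 / 2 by rewrite ltr_pdivrMr; lra.
  have : 0 < 8 * theta / N by rewrite divr_gt0 //; lra.
  by rewrite /s1 => ? ?; apply/andP; split; lra.
have [||r r01 E] := @is_derive_MVT chi dchi s0 s1; first by have /andP[] := s1P.
  move=> s /andP[sa sb]; apply: dchiP; rewrite sa (le_lt_trans sb) //.
  by have /andP[] := s1P.
have : dchi r * (s1 - s0) <= 0.
  have /andP[ra rb] := r01; have /andP[sa sb] := s1P.
  by rewrite mulr_le0_ge0 ?subr_ge0 // dchi0 // ra (le_lt_trans rb).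
have s1E : s1 / theta = s0 / theta + 8 / N.
  by rewrite /s1; field; apply/andP; split; rewrite gt_eqF //; lra.
have p1 : 0 < (psi s1)^-1 by rewrite invr_gt0 psi_gt0.
have p0 : (psi s0)^-1 <= 8 / N.
  have Np : 0 < N / 8 by lra.
  by rewrite -invf_div lef_pV2 ?posrE // (lt_le_trans Np).
by rewrite -E /chi s1E; lra.
Qed.

(** This is [riccati_bound] along the ray: the slope [psi] of [f] has the squared local norm of [v]
    as derivative, [barrier_gradient] is the Riccati inequality, and self-concordance keeps the
    local norm of [v] at least half its value at [x] while [s * N <= 1 / 2]. *)
Lemma barrier_ball theta D f x v : 0 < theta -> self_concordant_barrier theta D f ->
  D x -> (forall s : R, 0 <= s < 1 -> D (x + s *: v)) ->
  0 <= (gradient f x *m v^T) 0 0 -> local_norm f x v <= 1 + 16 * theta.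
Proof.
move=> th0 hb Dx Dl g0.
have [->|v0] := eqVneq v 0.
  rewrite /local_norm !mul0mx mxE sqrtr0; lra.
have sqr_half (a b : R) : 0 < a -> a / 2 <= b -> a ^+ 2 / 4 <= b ^+ 2.
  by move=> a0 ab; nra.
have [[oD _ C2 pd] _ sc] := hb.1.
set N := local_norm f x v.
pose psi (s : R) : R := (gradient f (x + s *: v) *m v^T) 0 0.
pose N2 (s : R) : R := (v *m hessian f (x + s *: v) *m v^T) 0 0.
have N2E (s : R) : 0 <= s < 1 -> N2 s = local_norm f (x + s *: v) v ^+ 2.
  by move=> s01; rewrite sqr_sqrtr // ltW // (pd _ (Dl _ s01)).
apply: (@riccati_bound psi N2) => //.
- move=> s s01; apply: (@is_derive_line _ (fun z => (gradient f z *m v^T) 0 0)).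
  by apply: derive_hessian; have [] := C2 _ (Dl s s01).
- by move=> s s01; apply: barrier_gradient hb _; exact: Dl.
- move=> s s01 sN; have /andP[s0 s1] := s01.
  have nsv : local_norm f x (s *: v) = s * N.
    rewrite /N /local_norm linearZ /= -!scalemxAl -scalemxAr scalerA mxE.
    by rewrite sqrtrM ?mulr_ge0 // -expr2 sqrtr_sqr ger0_norm.
  have nsv' : local_norm f x (- (s *: v)) = s * N.
    by rewrite -nsv /local_norm linearN /= !mulNmx mulmxN opprK.
  have by1 : local_ball f x x 1 (x + s *: v).
    by rewrite /local_ball /= opprD addrA subrr add0r nsv'; lra.
  have /andP[+ _] := sc x Dx _ by1 v v0.
  have Ngt0 : 0 < N by rewrite sqrtr_gt0 pd.
  rewrite (addrC x) addrK nsv -/N ler_pdivlMr // addrC => sc1.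
  have NN : N / 2 <= local_norm f (x + s *: v) v.
    by apply: le_trans sc1; rewrite mulrC; apply: ler_wpM2r; lra.
  by rewrite N2E //; exact: sqr_half.
- by rewrite /psi scale0r addr0.
Qed.

End Barrier.

(** * The feasible set and the central points *)

Section Feasible.
Context {R : realType}.

(** The terms of the monotone chain, numbered from 0 to [n]; both end terms differ from coordinates
    of the point. *)
Definition chain n (t : R) (X : nat -> R) k : R :=
  if k == 0%N then 0 else if (k < n)%N then X k else t `^ u n * X n.

(** Points are sequences here, so that sums and inductions on the index involve no ordinals. *)
Definition feasible n (t : R) (X : nat -> R) : Prop :=
  [/\ forall i, (1 <= i < n)%N ->
        t `^ (- u i) * (\sum_(1 <= j < i) X j) + t `^ (- u i.+1 + 1) * X i
        <= (\sum_(i.+1 <= j < n) t `^ (- u j) * X j) + X n + t `^ (- u n),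
      \sum_(1 <= j < n.+1) X j <= 1 &
      forall k, (k < n)%N -> chain n t X k <= chain n t X k.+1].

Lemma cex_feasibleE n t (x : 'rV[R]_n) : (0 < n)%N ->
  cex_feasible n t x <-> feasible n t (coord x).
Proof.
move=> n0.
pose s : seq R := 0 :: rcons [seq coord x j | j <- index_iota 1 n] (t `^ u n * coord x n).
have ss : size s = n.+1 by rewrite /= size_rcons size_map size_iota subn1 prednK.
have sE k : (k <= n)%N -> nth 0 s k = chain n t (coord x) k.
  case: k => [//|k] kn; rewrite /chain /= nth_rcons size_map size_iota.
  have -> : (k < n - 1)%N = (k.+1 < n)%N by rewrite ltn_subRL.
  case: ifPn => [kn1|kn1]; last by rewrite ifT //; apply/eqP; lia.
  rewrite (nth_map 0%N) ?size_iota; last by lia.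
  by rewrite nth_iota ?add1n //; lia.
have E : sorted <=%R s <-> forall k, (k < n)%N ->
    chain n t (coord x) k <= chain n t (coord x) k.+1.
  split => [/(sortedP 0) H k kn|H]; first by rewrite -!sE ?H ?ss //; lia.
  by apply/(sortedP 0) => k; rewrite ss ltnS => kn; rewrite !sE ?H //; lia.
by split=> [[? ? /E ?]|[? ? /E ?]].
Qed.

Lemma coordE n (x : 'rV[R]_n) (i : 'I_n) : x 0 i = coord x i.+1.
Proof. by rewrite /coord /= valK. Qed.

Lemma coord_row n (X : nat -> R) k : (1 <= k <= n)%N ->
  coord (\row_(i < n) X i.+1) k = X k.
Proof.
move=> kn; have k1 : (k.-1 < n)%N by lia.
rewrite -[in LHS](prednK (n := k)); last by lia.
by rewrite -(@coordE n _ (Ordinal k1)) mxE /= prednK //; lia.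
Qed.

Lemma coord_lin n (x y : 'rV[R]_n) (a b : R) k :
  coord (a *: x + b *: y) k = a * coord x k + b * coord y k.
Proof. by rewrite /coord; case: insub => [i|]; rewrite ?mxE // !mulr0 addr0. Qed.

Lemma eq_feasible n (t : R) (X Y : nat -> R) : (0 < n)%N ->
  (forall k, (1 <= k <= n)%N -> X k = Y k) -> feasible n t X -> feasible n t Y.
Proof.
move=> n0 XY [H1 H2 H3].
have chE k : (k <= n)%N -> chain n t X k = chain n t Y k.
  by rewrite /chain; case: k => //= k kn; rewrite !XY //; lia.
split.
- move=> i ni; have := H1 i ni; rewrite !XY; try lia.
  rewrite (eq_big_nat _ _ (F2 := Y)); last by move=> j ?; rewrite XY //; lia.
  by rewrite [in leRHS](eq_big_nat _ _ (F2 := fun j => t `^ (- u j) * Y j)) // => j ?;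
    rewrite XY //; lia.
- by rewrite -(eq_big_nat _ _ (F1 := X)) // => j ?; rewrite XY.
- by move=> k kn; rewrite -!chE ?H3 //; lia.
Qed.

Lemma feasible_convex n (t : R) (X Y : nat -> R) (a b : R) :
  0 <= a -> 0 <= b -> a + b = 1 -> feasible n t X -> feasible n t Y ->
  feasible n t (fun k => a * X k + b * Y k).
Proof.
move=> a0 b0 ab [X1 X2 X3] [Y1 Y2 Y3].
have sumE (r s : nat) (C : nat -> R) : \sum_(r <= j < s) C j * (a * X j + b * Y j) =
    a * (\sum_(r <= j < s) C j * X j) + b * (\sum_(r <= j < s) C j * Y j).
  by rewrite !mulr_sumr -big_split; apply: eq_bigr => j _ /=; ring.
have sumE1 (r s : nat) : \sum_(r <= j < s) (a * X j + b * Y j) =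
    a * (\sum_(r <= j < s) X j) + b * (\sum_(r <= j < s) Y j).
  by rewrite !mulr_sumr -big_split.
have chE k : chain n t (fun k => a * X k + b * Y k) k = a * chain n t X k + b * chain n t Y k.
  by rewrite /chain; case: eqP => _; last case: ifP => _; ring.
split=> [i ni||k kn].
- rewrite sumE sumE1.
  have := lerD (ler_wpM2l a0 (X1 i ni)) (ler_wpM2l b0 (Y1 i ni)).
  move: (t `^ (- u n)) => T.
  have : T = a * T + b * T by rewrite -mulrDl ab mul1r.
  by lra.
- rewrite sumE1 -ab.
  by have := lerD (ler_wpM2l a0 X2) (ler_wpM2l b0 Y2); rewrite !mulr1.
- by rewrite !chE lerD // ler_wpM2l // ?X3 ?Y3.
Qed.

(** The homothety [h] inverts the map sending [z] to [(1 - s) z + s y] and takes the given point to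
    [c]. The preimage of [A] under [h] is therefore a neighborhood of that point, and convexity puts
    this preimage inside [A]. *)
Lemma interior_segment n (A : set 'rV[R]_n) c y (s : R) :
  (forall a b : 'rV[R]_n, A a -> A b ->
    forall r : R, 0 <= r <= 1 -> A ((1 - r) *: a + r *: b)) ->
  A° c -> A y -> 0 <= s < 1 -> A° (c + s *: (y - c)).
Proof.
move=> cA Ac Ay /andP[s0 s1].
have s1' : 1 - s != 0 by rewrite subr_eq0 gt_eqF.
pose h (z : 'rV[R]_n) := (1 - s)^-1 *: (z - s *: y).
have hc : h (c + s *: (y - c)) = c.
  have -> : c + s *: (y - c) = (1 - s) *: c + s *: y.
    by rewrite scalerBr scalerBl scale1r [s *: y - _]addrC addrA.
  by rewrite /h addrK scalerA mulVf // scale1r.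
have ch : {for (c + s *: (y - c)), continuous h}.
  apply: (continuous_comp (f := fun z : 'rV[R]_n => z - s *: y)); last first.
    exact: scaler_continuous.
  by apply: continuousB; [exact: cvg_id|exact: cst_continuous].
have Ah : nbhs (c + s *: (y - c)) (h @^-1` A) by apply: ch; rewrite hc.
rewrite /interior; apply: (filterS _ Ah) => z Az.
have -> : z = (1 - s) *: h z + s *: y by rewrite /h scalerA divff // scale1r subrK.
by apply: cA => //; apply/andP; split => //; exact: ltW.
Qed.

Lemma is_derive_ge0 (h : R -> R) (d : R) : is_derive (0 : R) 1 h d ->
  (forall s : R, 0 < s < 1 -> h 0 <= h s) -> 0 <= d.
Proof.
move=> [/cvg_ex[l hl] hd] hmin.
have dl : l = d by rewrite -hd; apply/esym/cvg_lim.
subst l; rewrite leNgt; apply/negP => d0.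
have Hn : nbhs (0 : R) (fun k : R => k != 0 ->
    k^-1 *: ((h \o shift 0) (k *: 1) - h 0) < 0).
  exact: (cvgr_lt _ hl _ d0).
have [e e0 He] := (nbhs_ballP _ _).1 Hn.
pose s := Num.min (e / 2) (1 / 2).
have s0 : 0 < s by rewrite lt_min !divr_gt0.
have se : s < e by rewrite gt_min ltr_pdivrMr // ltr_pMr // ltr1n.
have s1 : s < 1 by rewrite gt_min; apply/orP; right; lra.
have : s^-1 *: ((h \o shift 0) (s *: 1) - h 0) < 0.
  apply: He; last by rewrite gt_eqF.
  by rewrite /ball /= sub0r normrN gtr0_norm.
rewrite /= addr0 [s *: 1](mulr1) ltNge => /negP; apply.
by rewrite mulr_ge0 ?invr_ge0 ?(ltW s0) // subr_ge0 hmin // s0.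
Qed.

Lemma chain_mono n (t : R) (X : nat -> R) j k : feasible n t X ->
  (j <= k <= n)%N -> chain n t X j <= chain n t X k.
Proof.
move=> [_ _ H]; elim: k => [|k IH]; first by rewrite leqn0 => /andP[/eqP->].
move=> /andP[jk kn]; move: jk; rewrite leq_eqVlt => /predU1P[->//|jk].
by apply: le_trans (H k kn); apply: IH; lia.
Qed.

Lemma feasible_ge0 n (t : R) (X : nat -> R) k : 0 < t -> feasible n t X ->
  (1 <= k <= n)%N -> 0 <= X k.
Proof.
move=> t0 XP kn; have := @chain_mono n t X 0 k XP.
have -> : (0 <= k <= n)%N by lia.
rewrite /chain /= => /(_ isT); case: eqP => [|_]; first by lia.
case: ifPn => // nk; have -> : k = n by lia.
by rewrite pmulr_rge0 // powR_gt0.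
Qed.

Lemma feasible_le_last n (t : R) (X : nat -> R) j : feasible n t X ->
  (1 <= j < n)%N -> X j <= t `^ u n * X n.
Proof.
move=> XP jk; have := @chain_mono n t X j n XP.
have -> : (j <= n <= n)%N by lia.
rewrite /chain /= => /(_ isT); case: eqP => [|_]; first by lia.
by case: eqP => [|_]; [lia|rewrite ltnn ifT //; lia].
Qed.

Lemma feasible_le1 n (t : R) (X : nat -> R) k : 0 < t -> feasible n t X ->
  (1 <= k <= n)%N -> X k <= 1.
Proof.
move=> t0 XP kn; have [_ + _] := XP; apply: le_trans.
rewrite (bigD1_seq k) ?iota_uniq ?mem_index_iota //= ler_wpDr //.
rewrite big_seq_cond sumr_ge0 // => j /andP[]; rewrite mem_index_iota => ? _.
exact: feasible_ge0 XP _.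
Qed.

End Feasible.

(** * Comparison of a central point with the feasible points *)

Section Central.
Context {R : realType}.

(** Towards [y] the linear term does not increase, so minimality makes the slope of [f] at [c]
    nonnegative and [barrier_ball] bounds the local norm of [y - c] by [K]. A point beyond [c] on
    the side opposite to [y] is then still feasible, and the bound expresses that its coordinates
    are nonnegative. *)
Lemma central_point_bound (theta : R) n (t eta : R) f (c y : 'rV[R]_n) :
  0 < theta -> (0 < n)%N -> 0 < t -> 0 < eta ->
  self_concordant_barrier theta (cex_feasible n t)° f ->
  is_central_point f t eta c -> cex_feasible n t y -> coord y n <= coord c n ->
  forall k, (1 <= k <= n)%N -> coord y k <= (3 + 16 * theta) * coord c k.
Proof.
move=> th0 n0 t0 eta0 hb [cD cmin] yP ycn k kn.
set D := (cex_feasible n t)° in hb cD cmin.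
have cvx (a b : 'rV[R]_n) : cex_feasible n t a -> cex_feasible n t b ->
    forall r : R, 0 <= r <= 1 -> cex_feasible n t ((1 - r) *: a + r *: b).
  move=> /(cex_feasibleE t _ n0) aP /(cex_feasibleE t _ n0) bP r /andP[r0 r1].
  apply/cex_feasibleE => //.
  apply: (@eq_feasible _ _ _ (fun k => (1 - r) * coord a k + r * coord b k)) => //.
    by move=> j _; rewrite coord_lin.
  by apply: feasible_convex => //; rewrite ?subr_ge0 // subrK.
have Dl (s : R) : 0 <= s < 1 -> D (c + s *: (y - c)).
  exact: (interior_segment cvx cD yP).
have [[[oD _ C2 pd] balls _] _] := hb.
have [dfc _ _] := C2 c cD.
have g0 : 0 <= (gradient f c *m (y - c)^T) 0 0.
  pose h (s : R) : R := f (c + s *: (y - c)).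
  apply: (@is_derive_ge0 _ h).
    by apply: is_derive_line; rewrite scale0r addr0; exact: derive_gradient.
  move=> s /andP[s0 s1]; rewrite /h scale0r addr0.
  have [->//|ne] := eqVneq (c + s *: (y - c)) c.
  have := cmin _ (Dl s _) ne; rewrite (ltW s0) s1 => /(_ isT).
  have -> : c + s *: (y - c) = (1 - s) *: c + s *: y.
    by rewrite scalerBr scalerBl scale1r [s *: y - _]addrC addrA.
  rewrite coord_lin.
  set A := f _; set B := f _ => H; rewrite -subr_ge0.
  have : 0 <= eta * (s * (coord c n - coord y n)).
    by rewrite !mulr_ge0 ?subr_ge0 // ltW.
  by move: H; move: A B => A B; lra.
have lb := barrier_ball th0 hb cD Dl g0.
set K := 1 + 16 * theta in lb.
(* This keeps [c - tau *: (y - c)] in the unit local ball. From [tau y_k <= (1 + tau) c_k] results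
   the factor [(1 + tau) / tau = K + 2]. *)
pose tau := (K + 1)^-1.
have K1 : 0 < K + 1 by rewrite /K; lra.
have tau0 : 0 < tau by rewrite invr_gt0.
have Dz : D (c - tau *: (y - c)).
  apply: (balls c cD); rewrite /local_ball /= opprB addrC subrK.
  have -> : local_norm f c (tau *: (y - c)) = tau * local_norm f c (y - c).
    rewrite /local_norm linearZ /= -!scalemxAl -scalemxAr scalerA mxE.
    by rewrite sqrtrM ?mulr_ge0 ?(ltW tau0) // -expr2 sqrtr_sqr gtr0_norm.
  apply: (@le_lt_trans _ _ (tau * K)); first by rewrite ler_wpM2l // ltW.
  by rewrite /tau mulrC ltr_pdivrMr // mul1r ltrDl.
have /(cex_feasibleE t _ n0) zP := interior_subset Dz.
have : 0 <= coord (c - tau *: (y - c)) k by exact: feasible_ge0 zP kn.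
have -> : c - tau *: (y - c) = (1 + tau) *: c + (- tau) *: y.
  by rewrite scalerBr opprB scalerDl scale1r scaleNr addrA.
rewrite coord_lin => H.
have tK : tau * (K + 1) = 1 by rewrite mulVf // gt_eqF.
rewrite -(ler_pM2l tau0) mulrA (_ : tau * (3 + 16 * theta) = 1 + tau); first lra.
by move: tK; rewrite /K; lra.
Qed.

End Central.

(** * Logarithmic limit of the central path *)

Section Digits.
Context {R : realType}.
Variable q : nat.

(** With [i = m.+1], so that [u i.+1 = wgt m - 1], and [q = a * 2 ^ i + r] with
    [r < 2 ^ i], [hi q m] is [3 * 2 ^ (i - 1) * a] and [lo q m] is [3 * r].
    At [x_n = t `^ - (3 * q + e)] the right-hand side of the i-th constraint
    has order [max (t `^ - (hi + lo + e)) (t `^ - (hi + wgt - 1))]. *)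
Definition wgt (m : nat) : R := (3 * 2 ^ m)%:R.
Definition hi (m : nat) : R := (3 * 2 ^ m * (q %/ 2 ^ m.+1))%:R.
Definition lo (m : nat) : R := (3 * (q %% 2 ^ m.+1))%:R.

Lemma u_wgt m : u m.+2 = wgt m - 1 :> R.
Proof. by rewrite /u /wgt (_ : m.+2%:Z - 2 = m) ?natrM ?natrX //; lia. Qed.

Lemma wgtS m : wgt m.+1 = 2 * wgt m.
Proof. by rewrite /wgt -natrM; congr _%:R; rewrite expnS; lia. Qed.

Lemma wgt_ge3 m : 3 <= wgt m.
Proof. by rewrite /wgt ler_nat; have := expn_gt0 2 m; lia. Qed.

Lemma hi_ge0 m : 0 <= hi m. Proof. exact: ler0n. Qed.
Lemma lo_ge0 m : 0 <= lo m. Proof. exact: ler0n. Qed.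

(** The cases are the binary digit [m] of [q], 0 or 1; both numbers are multiples of 3, whence the
    margin. *)
Lemma lo_cases m : lo m + 3 <= wgt m \/ wgt m <= lo m.
Proof.
rewrite /lo /wgt -natrD !ler_nat.
by have [|] := leqP (2 ^ m) (q %% 2 ^ m.+1); lia.
Qed.

(** The cases are the binary digit [m.+1] of [q], 0 or 1. *)
Lemma digit_step m :
  [/\ hi m = hi m.+1, lo m.+1 = lo m & lo m.+1 + 3 <= wgt m.+1] \/
  hi m = hi m.+1 + wgt m /\ lo m.+1 = lo m + 2 * wgt m.
Proof.
have P1 : (2 ^ m.+1 = 2 * 2 ^ m)%N by rewrite expnS.
have P2 : (2 ^ m.+2 = 2 ^ m.+1 * 2)%N by rewrite expnSr.
have D1 := divn_eq q (2 ^ m.+1); have D2 := divn_eq q (2 ^ m.+2).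
have A2 := divn_eq (q %/ 2 ^ m.+1) 2; have b2 := ltn_pmod (q %/ 2 ^ m.+1) (isT : 0 < 2)%N.
have M1 : (q %% 2 ^ m.+1 < 2 ^ m.+1)%N by rewrite ltn_mod expn_gt0.
rewrite /hi /lo /wgt; move: D1 D2 M1 A2 b2; rewrite -divnMA -P2.
move: (q %/ 2 ^ m.+2)%N (q %/ 2 ^ m.+1)%N (q %% 2 ^ m.+1)%N (q %% 2 ^ m.+2)%N.
move=> a2 a1 r1 r2; rewrite P2 P1; move: (2 ^ m)%N (a1 %% 2)%N => s [|[|//]].
- move=> D1 D2 M1 A2 _; left; subst a1.
  have -> : r2 = r1 by lia.
  by split=> //; [congr _%:R|rewrite -natrD ler_nat]; lia.
- move=> D1 D2 M1 A2 _; right; subst a1.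
  have -> : r2 = (r1 + 2 * s)%N by lia.
  by rewrite -!natrM -!natrD; split; congr _%:R; lia.
Qed.

Lemma digit_top N : (q < 2 ^ N.+1)%N -> hi N = 0 /\ lo N = 3 * q%:R.
Proof. by move=> qN; rewrite /hi /lo divn_small // modn_small // muln0 natrM. Qed.

End Digits.

(** * Test points close to the central path *)

Section Peak.
Context {R : realType}.

(** For [0 <= e <= 1], [- peak q e m] is the [t]-exponent of [x_(m.+1)] on the
    central path where [x_n] has exponent [- (3 * q + e)]. *)
Definition peak (q : nat) (e : R) m : R :=
  hi q m + (if wgt m <= lo q m :> R then lo q m - wgt m + 1 + e else 0).

(** The factors [2 ^+ k] absorb the sums on the left of the constraints: on the
    right of the i-th one, all coordinates have index larger than [i]. *)
Definition peak_point (t : R) N q (eps e : R) (k : nat) : R :=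
  eps * 2 ^+ k * t `^ (- (if k == N.+2 then 3 * q%:R + e else peak q e k.-1)).

Lemma peak_point_top t N q eps e :
  peak_point t N q eps e N.+2 = eps * 2 ^+ N.+2 * t `^ (- (3 * q%:R + e)).
Proof. by rewrite /peak_point eqxx. Qed.

Lemma peak_pointS t N q eps e m : (m <= N)%N ->
  peak_point t N q eps e m.+1 = eps * 2 ^+ m.+1 * t `^ (- peak q e m).
Proof. by move=> mN; rewrite /peak_point ifF //; apply/eqP; lia. Qed.

Lemma peak_ge_hi q (e : R) m : 0 <= e -> hi q m <= peak q e m.
Proof. by move=> e0; rewrite /peak; case: ifP => wl; lra. Qed.

Lemma peak_monoS q (e : R) m : 0 <= e <= 1 -> peak q e m.+1 <= peak q e m.
Proof.
move=> /andP[e0 e1]; rewrite /peak.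
have w3 := wgt_ge3 m (R := R); have l0 := lo_ge0 q m (R := R); have wS := wgtS m (R := R).
case: (digit_step q m (R := R)) => [[hE lE l3]|[hE lE]];
  case: (lo_cases q m (R := R)) => l1; case: ifP => /idP c1; case: ifP => /idP c2; lra.
Qed.

Lemma peak_mono q (e : R) j m : 0 <= e <= 1 -> (j <= m)%N -> peak q e m <= peak q e j.
Proof.
move=> e01; elim: m => [|m IH]; first by rewrite leqn0 => /eqP ->.
rewrite leq_eqVlt => /predU1P[->//|jm].
by apply: le_trans (peak_monoS _ _ e01) _; exact: IH.
Qed.

Lemma scaled_pow2_ge0 (eps : R) k : 0 <= eps -> 0 <= eps * 2 ^+ k.
Proof. by move=> eps0; apply: mulr_ge0 => //; exact: exprn_ge0. Qed.

Lemma scaled_pow2S (eps : R) k : 0 <= eps -> eps * 2 ^+ k <= eps * 2 ^+ k.+1.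
Proof.
move=> eps0; apply: ler_wpM2l => //; rewrite exprS; apply: ler_peMl; last by rewrite ler1n.
exact: exprn_ge0.
Qed.

Lemma peak_coef_ge0 (t eps : R) k (z : R) : 0 <= eps -> 0 <= eps * 2 ^+ k * t `^ z.
Proof. by move=> eps0; apply: mulr_ge0 (powR_ge0 _ _); exact: scaled_pow2_ge0. Qed.

Lemma geom_sum m : \sum_(1 <= j < m) (2 : R) ^+ j <= 2 ^+ m.
Proof.
elim: m => [|m IH]; first by rewrite big_geq.
case: m IH => [|m] IH; first by rewrite big_geq // exprn_ge0.
by rewrite big_nat_recr //= [leRHS]exprSr; lra.
Qed.

End Peak.

(** * Upper bounds on feasible points, feasibility of the test points *)

Section Bounds.
Context {R : realType}.
Variable t : R.
Hypothesis t1 : 1 < t.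

Lemma powD a b : t `^ (a + b) = t `^ a * t `^ b.
Proof. by rewrite powRD //; apply/implyP => _; rewrite gt_eqF // (lt_trans ltr01). Qed.

Lemma pow_gt0 z : 0 < t `^ z.
Proof. by rewrite powR_gt0 // (lt_trans ltr01). Qed.

Lemma pow_le a b : a <= b -> t `^ a <= t `^ b.
Proof. by move=> ab; apply: ler_powR ab; exact: ltW. Qed.

Definition rhs n (X : nat -> R) i : R :=
  (\sum_(i.+1 <= j < n) t `^ (- u j) * X j) + X n + t `^ (- u n).

Lemma rhs_top N X : rhs N.+2 X N.+1 = X N.+2 + t `^ (- u N.+2).
Proof. by rewrite /rhs big_geq // add0r. Qed.

(** Lowering the index of the constraint adds a single term to the right-hand side; this drives the
    two downward inductions on [m]. *)
Lemma rhs_step N X m : (m < N)%N ->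
  rhs N.+2 X m.+1 = t `^ (1 - wgt m) * X m.+2 + rhs N.+2 X m.+2.
Proof.
by move=> mN; rewrite /rhs big_ltn ?ltnS // u_wgt opprB !addrA.
Qed.

(** On the left of the constraint only the own term of [X m.+1] is kept. *)
Lemma feasible_rhs_own n X m : feasible n t X -> (m.+1 < n)%N ->
  X m.+1 <= t `^ (wgt m - 2) * rhs n X m.+1.
Proof.
move=> XP mn; have [+ _ _] := XP => /(_ m.+1); rewrite mn => /(_ isT) H.
rewrite -(ler_pM2l (pow_gt0 (- u m.+2 + 1))) mulrA -powD u_wgt.
rewrite (_ : - _ + 1 + _ = 0); last by ring.
rewrite powRr0 mul1r; apply: le_trans H; rewrite u_wgt lerDr mulr_ge0 ?powR_ge0 //.
rewrite big_seq_cond sumr_ge0 // => j /andP[]; rewrite mem_index_iota => ? _.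
by apply: feasible_ge0 XP _; [exact: lt_trans t1|lia].
Qed.

(** On the left of the next constraint a single term of the sum is kept. *)
Lemma feasible_rhs_below n X m j : feasible n t X -> (m.+2 < n)%N ->
  (1 <= j <= m.+1)%N -> X j <= t `^ (wgt m - 1) * rhs n X m.+2.
Proof.
move=> XP mn jm; have [+ _ _] := XP => /(_ m.+2); rewrite mn => /(_ isT) H.
have t0 : 0 < t by exact: lt_trans t1.
rewrite -(ler_pM2l (pow_gt0 (- u m.+2))) mulrA -powD u_wgt.
rewrite (_ : - _ + _ = 0); last by ring.
rewrite powRr0 mul1r; apply: le_trans H; rewrite u_wgt.
have X0 : 0 <= t `^ (- u m.+3 + 1) * X m.+2.
  by rewrite mulr_ge0 ?powR_ge0 // (feasible_ge0 t0 XP) //; lia.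
apply: le_trans (_ : _ <= t `^ (- (wgt m - 1)) * \sum_(1 <= j < m.+2) X j) _;
  last by rewrite lerDl.
rewrite ler_pM2l ?pow_gt0 // (bigD1_seq j) ?iota_uniq ?mem_index_iota //= lerDl.
rewrite big_seq_cond sumr_ge0 // => l /andP[]; rewrite mem_index_iota => ? _.
by apply: feasible_ge0 XP _ => //; lia.
Qed.

Lemma pow_sum_le (C a b c d x : R) : 0 <= C -> c <= a -> d <= b ->
  x <= C * (t `^ (- a) + t `^ (- b)) -> x <= C * (t `^ (- c) + t `^ (- d)).
Proof.
move=> C0 ca db; move/le_trans; apply.
by rewrite ler_wpM2l // lerD // pow_le // lerN2.
Qed.

(** Downward induction from [m = N], where the second bound is [X j <= 1] and the third is the end
    of the monotone chain. Each step at most doubles the constant. The room left by [-1 <= e] allows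
    a use half a unit before a kink. *)
Lemma upper_bounds N q (e : R) X : (q < 2 ^ N.+1)%N -> -1 <= e ->
  feasible N.+2 t X -> X N.+2 <= t `^ (- (3 * q%:R + e)) ->
  forall d m, (m + d)%N = N ->
  [/\ rhs N.+2 X m.+1 <= 2 ^+ d * (t `^ (- (hi q m + lo q m + e))
                                   + t `^ (- (hi q m + wgt m - 1))),
      forall j, (1 <= j <= m.+1)%N -> X j <= 2 ^+ d * t `^ (- hi q m) &
      forall j, (1 <= j <= m.+1)%N ->
        X j <= 2 ^+ d * (t `^ (- (hi q m + lo q m + e - wgt m + 1))
                         + t `^ (- (hi q m + wgt m)))].
Proof.
move=> qN e1 XP Xn.
have t0 : 0 < t by exact: lt_trans t1.
elim=> [|d IH] m.
  rewrite addn0 => ->; have [-> ->] := digit_top qN (R := R).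
  rewrite expr0 !mul1r !add0r; split.
  - by rewrite rhs_top u_wgt lerD2r.
  - by move=> j jN; rewrite oppr0 powRr0 (feasible_le1 t0 XP) //; lia.
  - move=> j jN; apply: le_trans (feasible_le_last XP _) _; first lia.
    rewrite ler_wpDr ?powR_ge0 // u_wgt.
    apply: le_trans (ler_wpM2l (powR_ge0 _ _) Xn) _.
    by rewrite -powD pow_le //; lra.
rewrite addnS -addSn => md; have [H1 H2 H3] := IH m.+1 md.
have mN : (m < N)%N by lia.
have mN2 : (m.+2 < N.+2)%N by lia.
rewrite exprS; set C := 2 ^+ d in H1 H2 H3 *.
have C0 : 0 <= C by rewrite exprn_ge0.
have C2 : C <= 2 * C by lra.
have w3 := wgt_ge3 m (R := R).
have below j : (1 <= j <= m.+1)%N -> X j <=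
    C * (t `^ (- (hi q m.+1 + lo q m.+1 + e - wgt m + 1))
       + t `^ (- (hi q m.+1 + wgt m))).
  move=> jm; apply: le_trans (feasible_rhs_below XP mN2 jm) _.
  apply: le_trans (ler_wpM2l (powR_ge0 _ _) H1) _.
  rewrite mulrCA mulrDr -!powD wgtS.
  by rewrite ler_wpM2l // lerD // pow_le //; lra.
have powge0 (a b : R) : 0 <= t `^ a + t `^ b by rewrite addr_ge0 ?powR_ge0.
have dbl (a b x : R) : x <= C * (t `^ a + t `^ b) -> x <= 2 * C * (t `^ a + t `^ b).
  by move/le_trans; apply; rewrite ler_wpM2r.
rewrite rhs_step //.
(* For digit 0 the second bound is inherited and the third comes from the constraint, through
   [below]; for digit 1 it is the other way round. The inherited bound also controls the new term of
   the right-hand side. *)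
case: (digit_step q m (R := R)) => [[hE lE l3]|[hE lE]].
- have lhi j : (1 <= j <= m.+1)%N -> X j <= 2 * C * t `^ (- hi q m).
    move=> jm; rewrite hE; have /andP[j1 jm1] := jm.
    apply: le_trans (H2 j _) _; first by rewrite j1 leqW.
    by rewrite ler_wpM2r ?powR_ge0.
  split => // [|j jm].
  + have H2' := H2 m.+2; rewrite leqnn in H2'.
    rewrite -mulrA mulr_natl mulr2n; apply: lerD.
      apply: le_trans (ler_wpM2l (powR_ge0 _ _) (H2' isT)) _.
      rewrite mulrCA -powD ler_wpM2l //.
      by rewrite ler_wpDl ?powR_ge0 // pow_le // hE; lra.
    by apply: pow_sum_le H1 => //; rewrite ?hE ?lE ?wgtS; lra.
  + by apply/dbl; apply: pow_sum_le (below j jm); rewrite ?hE ?lE.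
- have lom := lo_ge0 q m (R := R).
  split => [|j jm|j jm].
  + have H3' := H3 m.+2; rewrite leqnn in H3'.
    rewrite -mulrA mulr_natl mulr2n; apply: lerD.
      apply: le_trans (ler_wpM2l (powR_ge0 _ _) (H3' isT)) _.
      rewrite mulrCA mulrDr -!powD ler_wpM2l //.
      by rewrite lerD // pow_le // hE ?lE ?wgtS; lra.
    by apply: pow_sum_le H1 => //; rewrite ?hE ?lE ?wgtS; lra.
  + apply: le_trans (below j jm) _.
    rewrite (mulrC 2) -mulrA ler_wpM2l // mulr_natl mulr2n.
    by rewrite lerD // pow_le // hE ?lE; lra.
  + have H3' : (1 <= j <= m.+2)%N by have /andP[-> /leqW] := jm.
    by apply/dbl; apply: pow_sum_le (H3 j H3') => //; rewrite ?hE ?lE ?wgtS; lra.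
Qed.

(** The counterpart of [upper_bounds] from below: of the two bounds, one is inherited ([viaR]) and
    the other is supplied by the new term of the right-hand side ([viaP]), the digit of [q] deciding
    which. *)
Lemma peak_rhs N q (eps e : R) : (q < 2 ^ N.+1)%N -> 0 <= e <= 1 ->
  0 <= eps -> eps * 2 ^+ N.+2 <= 1 ->
  forall d m, (m + d)%N = N ->
  eps * 2 ^+ m.+2 * t `^ (- (hi q m + lo q m + e)) <=
    rhs N.+2 (peak_point t N q eps e) m.+1 /\
  eps * 2 ^+ m.+2 * t `^ (- (hi q m + wgt m - 1)) <=
    rhs N.+2 (peak_point t N q eps e) m.+1.
Proof.
move=> qN /andP[e0 e1] eps0 eps1.
elim=> [|d IH] m.
  rewrite addn0 => ->; have [-> ->] := digit_top qN (R := R).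
  rewrite rhs_top peak_point_top u_wgt !add0r; split.
    by rewrite lerDl powR_ge0.
  apply: ler_wpDl; first exact: peak_coef_ge0.
  by rewrite -[leRHS]mul1r ler_wpM2r ?powR_ge0.
rewrite addnS -addSn => md; have [H1 H2] := IH m.+1 md.
rewrite rhs_step; last lia.
rewrite peak_pointS; last lia.
have P0 (z : R) : 0 <= eps * 2 ^+ m.+2 * t `^ z by exact: peak_coef_ge0.
have rhs0 : 0 <= rhs N.+2 (peak_point t N q eps e) m.+2.
  by apply: (le_trans _ H1); exact: peak_coef_ge0.
have viaR (x y : R) : y <= x ->
    eps * 2 ^+ m.+3 * t `^ (- y) <= rhs N.+2 (peak_point t N q eps e) m.+2 ->
    eps * 2 ^+ m.+2 * t `^ (- x) <= t `^ (1 - wgt m) *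
      (eps * 2 ^+ m.+2 * t `^ (- peak q e m.+1)) + rhs N.+2 (peak_point t N q eps e) m.+2.
  move=> yx H; apply: ler_wpDl; first by apply: mulr_ge0 (powR_ge0 _ _) (P0 _).
  apply: (le_trans _ H).
  apply: ler_pM (scaled_pow2_ge0 _ eps0) (powR_ge0 _ _) (scaled_pow2S _ eps0) _.
  by rewrite pow_le // lerN2.
have viaP (x : R) : peak q e m.+1 + wgt m - 1 <= x ->
    eps * 2 ^+ m.+2 * t `^ (- x) <= t `^ (1 - wgt m) *
      (eps * 2 ^+ m.+2 * t `^ (- peak q e m.+1)) + rhs N.+2 (peak_point t N q eps e) m.+2.
  move=> yx; apply: ler_wpDr => //; rewrite [leRHS]mulrCA -powD.
  by apply: ler_wpM2l (scaled_pow2_ge0 _ eps0) _ _ _; rewrite pow_le //; lra.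
have w3 := wgt_ge3 m (R := R).
case: (digit_step q m (R := R)) => [[hE lE l3]|[hE lE]].
- split; [apply: viaR H1|apply: viaP]; rewrite ?hE ?lE //.
  by rewrite /peak ifF; [lra|apply/negbTE; rewrite -ltNge; lra].
- have lom := lo_ge0 q m (R := R).
  split; [apply: viaP|apply: viaR H2]; rewrite hE ?wgtS; last lra.
  by rewrite /peak wgtS ifT; lra.
Qed.

Lemma peak_feasible N q (eps e : R) : (q < 2 ^ N.+1)%N -> 0 <= e <= 1 ->
  0 <= eps -> eps * 2 ^+ N.+3 <= 1 -> feasible N.+2 t (peak_point t N q eps e).
Proof.
move=> qN e01 eps0 eps1; have /andP[e0 e1] := e01.
have eps2 : eps * 2 ^+ N.+2 <= 1.
  by apply: (le_trans _ eps1); exact: scaled_pow2S.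
pose Y := peak_point t N q eps e.
have Y0 k : 0 <= Y k by exact: peak_coef_ge0.
have Y1 k : Y k <= eps * 2 ^+ k.
  rewrite -[leRHS]mulr1; apply: ler_wpM2l (scaled_pow2_ge0 _ eps0) _ _ _.
  rewrite -[leRHS](powRr0 t) pow_le //.
  rewrite oppr_le0; case: eqP => _; first by have := ler0n R q; lra.
  by apply: le_trans (peak_ge_hi _ _ e0); exact: hi_ge0.
split.
- case=> // m /andP[_ mN].
  have [RA RB] := @peak_rhs N q eps e qN e01 eps0 eps2 (N - m)%N m (subnKC (mN : (m <= N)%N)).
  (* The first bound on the right-hand side serves when digit [m] of [q] is 0, the second when it is
     1. The conditions on [M] concern the own term of the constraint and the last term of its sum;
     [peak_mono] extends the latter to the whole sum. *)
  have [M MR MP] : exists2 M : R, eps * 2 ^+ m.+2 * t `^ (- M) <= rhs N.+2 Y m.+1 &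
      M <= peak q e m + wgt m - 2 /\
      forall k, m = k.+1 -> M <= peak q e k + wgt k - 1.
    have w3 := wgt_ge3 m (R := R).
    case: (lo_cases q m (R := R)) => lw.
    + have pE : peak q e m = hi q m.
        by rewrite /peak ifF ?addr0 //; apply/negbTE; rewrite -ltNge; lra.
      eexists; first exact: RA; split; first by rewrite pE; lra.
      move=> k mk; subst m; move: lw w3 pE => lw w3 pE.
      case: (digit_step q k (R := R)) => [[hE lE l3]|[hE lE]]; last first.
        by have := lo_ge0 q k (R := R); move: lw; rewrite wgtS; lra.
      rewrite -hE lE /peak; case: ifP => c; last first.
        by case: (lo_cases q k (R := R)) => ?; [lra|move/negP: c].
      by lra.
    + have pE : peak q e m = hi q m + lo q m - wgt m + 1 + e by rewrite /peak lw; ring.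
      eexists; first exact: RB; split; first by rewrite pE; lra.
      move=> k mk; subst m; move: lw w3 pE => lw w3 pE.
      case: (digit_step q k (R := R)) => [[hE lE l3]|[hE lE]]; first lra.
      by have := peak_ge_hi q k e0; rewrite hE wgtS; lra.
  apply: le_trans MR.
  (* One half is for the sum of the earlier coordinates, by [geom_sum], the other for the own
     term. *)
  have -> : eps * 2 ^+ m.+2 * t `^ (- M) =
      eps * t `^ (- M) * 2 ^+ m.+1 + eps * t `^ (- M) * 2 ^+ m.+1.
    by rewrite exprS; ring.
  apply: lerD; last first.
    rewrite /Y peak_pointS // mulrC -!mulrA ler_wpM2l // (mulrC (t `^ _) (2 ^+ _)).
    rewrite ler_wpM2l ?exprn_ge0 // -powD pow_le // u_wgt; have [? _] := MP; lra.
  case: m mN RA RB MP => [|m] mN RA RB [_ MP].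
    by rewrite big_geq // mulr0 mulrAC peak_coef_ge0.
  apply: le_trans (ler_wpM2l _ (geom_sum m.+2)); last by rewrite mulr_ge0 ?powR_ge0.
  rewrite !mulr_sumr big_seq_cond [leRHS]big_seq_cond.
  apply: ler_sum => -[|j] /andP[]; rewrite mem_index_iota // => jm _.
  rewrite /Y peak_pointS; last lia.
  rewrite mulrC -!mulrA ler_wpM2l // (mulrC (t `^ (- M)) (2 ^+ _)) ler_wpM2l ?exprn_ge0 //.
  rewrite -powD pow_le // u_wgt.
  have jm' : (j <= m)%N by lia.
  by have := MP m erefl; have := peak_mono q e01 jm'; lra.
- apply: le_trans eps1; apply: le_trans (ler_wpM2l eps0 (geom_sum _)).
  by rewrite mulr_sumr; apply: ler_sum => j _; exact: Y1.
- move=> k kN; rewrite /chain /=; case: k kN => [|k] kN /=.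
    exact: Y0.
  rewrite kN -/Y; case: ifP => kN2.
    have k1 : (k <= N)%N by lia.
    have k2 : (k.+1 <= N)%N by lia.
    rewrite /Y (peak_pointS _ _ _ _ k1) (peak_pointS _ _ _ _ k2).
    apply: ler_pM (scaled_pow2_ge0 _ eps0) (powR_ge0 _ _) (scaled_pow2S _ eps0) _.
    by rewrite pow_le // lerN2 peak_monoS.
  have kE : k = N by lia.
  rewrite kE /Y peak_point_top (peak_pointS _ _ _ _ (leqnn N)) [leRHS]mulrCA -powD.
  apply: ler_pM (scaled_pow2_ge0 _ eps0) (powR_ge0 _ _) (scaled_pow2S _ eps0) _.
  rewrite pow_le // u_wgt /peak; have [-> ->] := digit_top qN (R := R).
  have := lo_cases q N (R := R); have [_ ->] := digit_top qN (R := R).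
  case: ifP => c ?; first lra.
  by have w3 := wgt_ge3 N (R := R); move/negP/negP: c; rewrite -ltNge; lra.
Qed.

End Bounds.

(** * Segments in the neighborhood *)

Section Shortcut.
Context {R : realType}.

(** [m] is the 2-adic valuation of [j]. *)
Lemma dyadic_digit M j : (0 < j < 2 ^ M)%N -> exists2 m, (m < M)%N & (j %% 2 ^ m.+1 = 2 ^ m)%N.
Proof.
elim: M j => [|M IH] j jM; first by move: jM; rewrite expn0; lia.
have j2 := odd_double_half j.
case: (boolP (odd j)) j2 => oj j2; first by exists 0%N; rewrite // expn1 modn2 oj.
have [|m mM mE] := IH j./2; first by move: jM; rewrite expnS; lia.
exists m.+1 => //; rewrite -j2 add0n -mul2n expnS -muln_modr mE.
by rewrite -expnS.
Qed.

(** [m] is the valuation of [c / 2] rounded up. For even [c] the lowest digit 1 of [q = c./2] is at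
    [m]; for odd [c] that of [q + 1] is, so the digits of [q] are 0 at [m] and 1 below. *)
Lemma growth_digit N c : (0 < c)%N -> (c.+1 < 2 ^ N.+2)%N ->
  exists2 m, (m <= N)%N &
    if odd c then lo c./2 m + 3 = wgt m :> R else lo c./2 m = wgt m :> R.
Proof.
move=> c0 cN; have c2 := odd_double_half c.
have [|m mN mE] := @dyadic_digit N.+1 (c./2 + odd c).
  by move: cN; rewrite expnS; lia.
exists m => //; rewrite /lo /wgt; have e0 := expn_gt0 2 m.
case: (odd c) mE => mE; last by rewrite addn0 in mE; rewrite mE.
have H : (c./2 %% 2 ^ m.+1).+1 = (2 ^ m)%N.
  have lt1 : (c./2 %% 2 ^ m.+1 < 2 ^ m.+1)%N by rewrite ltn_mod expn_gt0.
  have := mE; rewrite -modnDml; set r := (c./2 %% _)%N in lt1 *.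
  have [r1|r1] := ltnP (r + 1)%N (2 ^ m.+1)%N.
    by rewrite modn_small //; lia.
  have -> : (r + 1)%N = (2 ^ m.+1)%N by lia.
  by rewrite modnn; lia.
by rewrite -natrD; congr _%:R; lia.
Qed.

(** Half a unit before the kink a bound independent of [x_n] applies; half a unit after it, one
    proportional to [x_n] gains the exponent [1 / 2]. For [e = 0] these are the own constraint and
    the third bound of [upper_bounds]; for [e = 1] they are its second bound and the own
    constraint. *)
Lemma growth_upper (t : R) N q (e : R) m X : 1 < t -> (q < 2 ^ N.+1)%N -> (m <= N)%N ->
  (e = 0 /\ lo q m = wgt m :> R) \/ (e = 1 /\ lo q m + 3 = wgt m :> R) ->
  feasible N.+2 t X ->
  (X N.+2 <= t `^ (- (3 * q%:R + (e - 1 / 2))) ->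
     X m.+1 <= 2 ^+ N.+1 * t `^ (- peak q e m)) /\
  (X N.+2 <= t `^ (- (3 * q%:R + (e + 1 / 2))) ->
     X m.+1 <= 2 ^+ N.+1 * t `^ (- (peak q e m + 1 / 2))).
Proof.
move=> t1 qN mN cs XP; have w3 := wgt_ge3 m (R := R).
have mS : (1 <= m.+1 <= m.+1)%N by lia.
have mN2 : (m.+1 < N.+2)%N by lia.
have dN : (2 : R) ^+ (N - m) <= 2 ^+ N by rewrite ler_weXn2l ?ler1n // leq_subr.
have two (a b c : R) : c <= a -> c <= b ->
    2 ^+ (N - m) * (t `^ (- a) + t `^ (- b)) <= 2 ^+ N.+1 * t `^ (- c).
  move=> ca cb; apply: (@le_trans _ _ (2 ^+ N * (t `^ (- a) + t `^ (- b)))).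
    by apply: ler_wpM2r dN; apply: addr_ge0; exact: powR_ge0.
  rewrite exprSr -mulrA; apply: ler_wpM2l; first exact: exprn_ge0.
  by rewrite mulr_natl mulr2n; apply: lerD; rewrite pow_le // lerN2.
have viaR (e' c : R) : rhs t N.+2 X m.+1 <= 2 ^+ (N - m) *
     (t `^ (- (hi q m + lo q m + e')) + t `^ (- (hi q m + wgt m - 1))) ->
     c <= hi q m + lo q m + e' - wgt m + 2 -> c <= hi q m + 1 ->
     X m.+1 <= 2 ^+ N.+1 * t `^ (- c).
  move=> H1 ca cb; apply: le_trans (feasible_rhs_own t1 XP mN2) _.
  apply: le_trans (ler_wpM2l (powR_ge0 _ _) H1) _.
  rewrite mulrCA mulrDr -!powD //.
  rewrite (_ : wgt m - 2 - _ = - (hi q m + lo q m + e' - wgt m + 2)); last by ring.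
  rewrite (_ : wgt m - 2 - _ = - (hi q m + 1)); last by ring.
  exact: two.
have ub := upper_bounds t1 qN _ XP _ (subnKC mN).
case: cs => -[-> lE]; split=> Xn.
- have [|H1 _ _] := ub (0 - 1 / 2) _ Xn; first lra.
  by apply: viaR H1 _ _; rewrite /peak lE lexx; lra.
- have [|_ _ H3] := ub (0 + 1 / 2) _ Xn; first lra.
  by apply: le_trans (H3 _ mS) _; apply: two; rewrite /peak lE lexx; lra.
- have [|_ H2 _] := ub (1 - 1 / 2) _ Xn; first lra.
  apply: le_trans (H2 _ mS) _; rewrite /peak ifF; last by apply/negbTE; rewrite -ltNge; lra.
  rewrite addr0; apply: ler_wpM2r; first exact: powR_ge0.
  by apply: le_trans dN _; rewrite exprS; apply: ler_peMl; rewrite ?exprn_ge0 ?ler1n.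
- have [|H1 _ _] := ub (1 + 1 / 2) _ Xn; first lra.
  by apply: viaR H1 _ _; rewrite /peak ifF; first [lra|apply/negbTE; rewrite -ltNge; lra].
Qed.

Lemma coord_ord n k : (1 <= k <= n)%N ->
  exists i : 'I_n, forall x : 'rV[R]_n, coord x k = x 0 i.
Proof.
move=> kn; have k1 : (k.-1 < n)%N by lia.
by exists (Ordinal k1) => x; rewrite coordE /= prednK //; lia.
Qed.

(** As the values [T * s], [T], [T / s] show, the middle point is the barycenter of the outer ones
    with weights 1 and [s]. Its other coordinate, times [s + 1], is thus at most [2 * M * D],
    against the lower bound [c * D * (s + 1)]. *)
Lemma interpolation_bound (s T D c M A B Ai Bi rz ry rw : R) :
  1 < s -> 0 < T -> 0 < D -> 0 < c -> 0 < A - B ->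
  A - rz * (A - B) = T * s -> A - ry * (A - B) = T -> A - rw * (A - B) = T / s ->
  Ai - rz * (Ai - Bi) <= M * D -> Ai - rw * (Ai - Bi) <= M * (D / s) ->
  c * D <= Ai - ry * (Ai - Bi) -> 2 * M < c * s -> False.
Proof.
move=> s1 T0 D0 c0 AB zn yn wn zU wU yL big.
have s0 : 0 < s by exact: lt_trans s1.
set Z := Ai - rz * _ in zU; set Y := Ai - ry * _ in yL; set W := Ai - rw * _ in wU.
have YE : Y * (s + 1) = Z + W * s.
  have rzE : rz = (A - T * s) / (A - B) by rewrite -zn; field; rewrite gt_eqF.
  have ryE : ry = (A - T) / (A - B) by rewrite -yn; field; rewrite gt_eqF.
  have rwE : rw = (A - T / s) / (A - B) by rewrite -wn; field; rewrite gt_eqF.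
  rewrite /Y /Z /W rzE ryE rwE; field.
  by rewrite !gt_eqF.
have Ws : W * s <= M * D.
  have -> : M * D = M * (D / s) * s by field; rewrite gt_eqF.
  by apply: ler_wpM2r => //; exact: ltW.
have YL : c * D * (s + 1) <= Y * (s + 1) by apply: ler_wpM2r => //; lra.
have : c * D * (s + 1) <= 2 * M * D by rewrite YE in YL; lra.
have -> : c * D * (s + 1) = (c * s + c) * D by ring.
by rewrite ler_pM2r //; lra.
Qed.

Section Nbhd.
Variables (N : nat) (ml mu theta t : R) (f : 'rV[R]_N.+2 -> R).
Hypotheses (ml0 : 0 < ml) (mu1 : 1 < mu) (th0 : 0 < theta) (t1 : 1 < t).
Hypothesis hf : self_concordant_barrier theta (cex_feasible N.+2 t)° f.

Lemma nbhd_feasible x : mult_nbhd_path ml mu f t x -> feasible N.+2 t (coord x).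
Proof. by move=> [eta _ [/(cex_feasibleE _ _ (ltn0Sn _)) xP _]]. Qed.

(** A test point scaled so that its last coordinate does not exceed that of the central point is
    compared with it by [central_point_bound]; the factors [ml] and [mu] pass between [x] and the
    central point. *)
Lemma nbhd_lower x q (e : R) m : mult_nbhd_path ml mu f t x ->
  (q < 2 ^ N.+1)%N -> 0 <= e <= 1 -> (m <= N)%N ->
  coord x N.+2 = t `^ (- (3 * q%:R + e)) ->
  ml / (3 + 16 * theta) / (mu * 2 ^+ N.+3) * t `^ (- peak q e m) <= coord x m.+1.
Proof.
move=> [eta eta0 [xP xb]] qN e01 mN xn.
have xc k : (1 <= k <= N.+2)%N -> ml * coord (central_path f t eta) k <= coord x k
    <= mu * coord (central_path f t eta) k.
  by move=> /coord_ord[i iE]; rewrite !iE.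
have n1 : (1 <= N.+2 <= N.+2)%N by lia.
have t0 : 0 < t by exact: lt_trans t1.
have mu0 : 0 < mu by exact: lt_trans mu1.
(* The default value 0 of [central_path] is excluded because it would force [x_n <= 0]. *)
move: xc; rewrite /central_path; case: xgetP => [c _ cP|nc] xc; last first.
  have := xc _ n1; have [i ->] := coord_ord n1; rewrite mxE !mulr0 => /andP[_].
  by rewrite xn leNgt powR_gt0.
have K0 : 0 < 3 + 16 * theta.
  by move: th0 => ?; lra.
set K := 3 + 16 * theta in K0 *.
(* Small enough for [peak_feasible], and for the test point to satisfy [y_n <= x_n / mu <= c_n]. *)
pose eps := (mu * 2 ^+ N.+3)^-1.
have p3 : 0 < (2 : R) ^+ N.+3 by exact: exprn_gt0.
have mp0 : 0 < mu * 2 ^+ N.+3 by exact: mulr_gt0.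
have eps0 : 0 <= eps by rewrite invr_ge0 ltW.
have epsE : mu * (eps * 2 ^+ N.+3) = 1.
  by rewrite mulrCA /eps mulrC; apply: mulfV; rewrite gt_eqF.
have eps1 : eps * 2 ^+ N.+3 <= 1.
  have s0 := scaled_pow2_ge0 N.+3 eps0.
  by rewrite -[leRHS]epsE; apply: ler_peMl => //; exact: ltW.
have YP := peak_feasible t1 qN e01 eps0 eps1.
pose y : 'rV[R]_N.+2 := \row_(i < N.+2) peak_point t N q eps e i.+1.
have yk k : (1 <= k <= N.+2)%N -> coord y k = peak_point t N q eps e k.
  exact: coord_row.
have yP : cex_feasible N.+2 t y.
  apply/cex_feasibleE => //; apply: eq_feasible YP => // k kn.
  by rewrite yk.
have yn : coord y N.+2 <= coord c N.+2.
  have /andP[_ cn] := xc _ n1; rewrite yk // peak_point_top -(ler_pM2l mu0).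
  apply: (le_trans _ cn); rewrite xn mulrA -[leRHS]mul1r.
  apply: ler_wpM2r; first exact: powR_ge0.
  by rewrite -[leRHS]epsE; apply: ler_wpM2l; [exact: ltW|exact: scaled_pow2S].
have mS : (1 <= m.+1 <= N.+2)%N by rewrite /= ltnS (leq_trans mN).
have := central_point_bound th0 (ltn0Sn _) t0 eta0 hf cP yP yn mS.
have /andP[+ _] := xc _ mS; rewrite yk // (peak_pointS _ _ _ _ mN) -/K.
rewrite -/eps; move: (coord c _) (coord x _) => C X; set T := t `^ _ => cX.
have T0 : 0 <= T by exact: powR_ge0.
have epsT : eps * T <= eps * 2 ^+ m.+1 * T.
  apply: ler_wpM2r => //; apply: ler_peMr => //.
  by rewrite exprn_ege1 // ler1n.
move=> /(le_trans epsT); rewrite -ler_pdivrMl // => CK.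
apply: (le_trans _ cX); rewrite -!mulrA; apply: ler_wpM2l => //; exact: ltW.
Qed.

(** Where [x_n] crosses [t `^ (- kink c)] downwards, some coordinate [x_i] of the
    central path turns from constant to proportional to [x_n]. *)
Definition kink c : R := 3 * (c./2)%:R + (odd c)%:R.

(** Otherwise the segment has points of the neighborhood at [x_n] equal to [T * s], [T] and [T / s].
    At the coordinate given by [growth_digit], [growth_upper] bounds the outer points from above and
    [nbhd_lower] the middle one from below, which contradicts [interpolation_bound]. *)
Lemma no_shortcut a b c : (0 < c)%N -> (c.+1 < 2 ^ N.+2)%N ->
  2 * 2 ^+ N.+1 < ml / (3 + 16 * theta) / (mu * 2 ^+ N.+3) * t `^ (1 / 2) ->
  segment a b `<=` mult_nbhd_path ml mu f t ->
  t `^ (- kink c + 1 / 2) <= coord a N.+2 ->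
  t `^ (- kink c - 1 / 2) < coord b N.+2.
Proof.
move=> c0 cN big ab aN; rewrite ltNge; apply/negP => bN.
have [m mN mE] := growth_digit c0 cN.
pose q := c./2; pose e : R := (odd c)%:R.
have qN : (q < 2 ^ N.+1)%N.
  by have := odd_double_half c; move: cN; rewrite expnS /q; lia.
have e01 : 0 <= e <= 1 by rewrite /e; case: odd; rewrite ?lexx ?ler01.
have cs : (e = 0 /\ lo q m = wgt m :> R) \/ (e = 1 /\ lo q m + 3 = wgt m :> R).
  by rewrite /e /q; case: odd mE => ?; [right|left].
have kE : kink c = 3 * q%:R + e by [].
rewrite kE in aN bN.
set s := t `^ (1 / 2) in big.
have s1 : 1 < s.
  have s0 : 0 < s by exact: pow_gt0.
  have ss : s * s = t.
    rewrite -powD // (_ : 1 / 2 + 1 / 2 = 1); last by field.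
    by rewrite powRr1 // ltW // (lt_trans ltr01).
  rewrite ltNge; apply/negP => s1.
  by have := t1; rewrite -ss ltNge mulr_ile1 // ltW.
pose T := t `^ (- (3 * q%:R + e)).
have T0 : 0 < T by exact: pow_gt0.
have zE : t `^ (- (3 * q%:R + e) + 1 / 2) = T * s by rewrite powD.
have wE : t `^ (- (3 * q%:R + e) - 1 / 2) = T / s.
  by rewrite powD // /s -powRN.
rewrite zE in aN; rewrite wE in bN.
set A := coord a N.+2 in aN; set B := coord b N.+2 in bN.
pose P r : 'rV[R]_N.+2 := (1 - r) *: a + r *: b.
have Pc r k : coord (P r) k = coord a k - r * (coord a k - coord b k).
  by rewrite /P coord_lin; ring.
have sT : T / s < T by rewrite ltr_pdivrMr ?ltr_pMr // (lt_trans ltr01).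
have Ts : T < T * s by rewrite ltr_pMr.
have AB : 0 < A - B by lra.
have hit h : T / s <= h <= T * s -> exists2 r, coord (P r) N.+2 = h &
    mult_nbhd_path ml mu f t (P r).
  move=> /andP[h1 h2]; exists ((A - h) / (A - B)).
    rewrite Pc -/A -/B divfK ?gt_eqF //; ring.
  apply: ab; exists ((A - h) / (A - B)) => //=.
  rewrite in_itv /= divr_ge0 ?ler_pdivrMr //; lra.
have [rz zn zP] : exists2 r, coord (P r) N.+2 = T * s & mult_nbhd_path ml mu f t (P r).
  by apply: hit; apply/andP; split; lra.
have [ry yn yP] : exists2 r, coord (P r) N.+2 = T & mult_nbhd_path ml mu f t (P r).
  by apply: hit; apply/andP; split; lra.
have [rw wn wP] : exists2 r, coord (P r) N.+2 = T / s & mult_nbhd_path ml mu f t (P r).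
  by apply: hit; apply/andP; split; lra.
have [zU _] := growth_upper t1 qN mN cs (nbhd_feasible zP).
have [_ wU] := growth_upper t1 qN mN cs (nbhd_feasible wP).
have yL := nbhd_lower yP qN e01 mN yn.
have c00 : 0 < ml / (3 + 16 * theta) / (mu * 2 ^+ N.+3).
  have K0 : 0 < 3 + 16 * theta by move: th0 => ?; lra.
  have mu0 : 0 < mu by exact: lt_trans mu1.
  by apply: divr_gt0; [exact: divr_gt0|apply: mulr_gt0 => //; exact: exprn_gt0].
have wD : t `^ (- (peak q e m + 1 / 2)) = t `^ (- peak q e m) / s.
  by rewrite opprD powD // /s -powRN.
have wE' : t `^ (- (3 * q%:R + (e + 1 / 2))) = T / s.
  by rewrite -wE; congr (_ `^ _); ring.
have zE' : t `^ (- (3 * q%:R + (e - 1 / 2))) = T * s.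
  by rewrite -zE; congr (_ `^ _); ring.
move: zU wU yL big c00; rewrite zn wn wD wE' zE' => /(_ (lexx _)) zU /(_ (lexx _)) wU.
move: zn yn wn zU wU; rewrite !Pc -/A -/B.
have D0 : 0 < t `^ (- peak q e m) by exact: pow_gt0.
move: (ml / _ / _) (t `^ (- peak q e m)) (2 ^+ N.+1) D0 => c' D M D0.
move: (coord a m.+1) (coord b m.+1) => Ai Bi zn yn wn zU wU yL big c'0.
exact: (interpolation_bound s1 T0 D0 c'0 AB zn yn wn zU wU yL big).
Qed.

End Nbhd.
End Shortcut.

(** * Counting the kinks *)

(** The gaps are 1 and 2 in turn, so the windows of half-width [1 / 2] around the kinks do not
    overlap. *)
Lemma kink_succ (R : realType) c : kink c + 1 <= kink c.+1 :> R.
Proof.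
have H : (3 * c./2 + odd c + 1 <= 3 * c.+1./2 + odd c.+1)%N.
  have := odd_double_half c; have := odd_double_half c.+1; rewrite /=.
  by case: (odd c) => /=; lia.
move: H; rewrite /kink -(ler_nat R) !natrD; lra.
Qed.

(** Equality holds at the last index, [c = 2 ^ N.+2 - 1]. *)
Lemma kink_le (R : realType) N c : (c < 2 ^ N.+2)%N -> kink c <= 2 * u N.+2 :> R.
Proof.
move=> cN; rewrite u_wgt /wgt.
have H : (3 * c./2 + odd c + 2 <= 2 * (3 * 2 ^ N))%N.
  have := odd_double_half c; move: cN; rewrite !expnS.
  by case: (odd c) => /=; lia.
by move: H; rewrite /kink -(ler_nat R) !natrD; lra.
Qed.

Lemma sqrt_large (R : realType) (M t : R) : 0 <= M -> M ^+ 2 <= t -> M <= t `^ (1 / 2).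
Proof.
move=> M0 Mt; rewrite div1r powR12_sqrt; last by apply: le_trans Mt; exact: sqr_ge0.
by rewrite -[leLHS]ger0_norm // -sqrtr_sqr; exact: ler_wsqrtr.
Qed.

Theorem theorem25 (R : realType) (n : nat) (hn : (1 <= n)%N)
  (ml mu theta : R) (hml : 0 < ml < 1) (hmu : 1 < mu) (htheta : 0 < theta)
  (f : R -> 'rV[R]_n -> R)
  (hf : forall t : R, 1 < t ->
     self_concordant_barrier theta (cex_feasible n t)° (f t)) :
  forall kappa : R, 0 < kappa ->
  exists t0 : R, 1 < t0 /\
  forall t : R, t0 <= t ->
  forall (p : nat) (x : nat -> 'rV[R]_n),
    \bigcup_(k < p) segment (x k) (x k.+1) `<=` mult_nbhd_path ml mu (f t) t ->
    kappa <= coord (x 0%N) n ->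
    coord (x p) n <= 1 / t `^ (2 * u n) ->
    (2 ^ n - 1 <= p)%N.
Proof.
move=> kappa kappa0; have /andP[ml0 _] := hml.
have ki0 : 0 < kappa^-1 by rewrite invr_gt0.
case: n hn f hf => [//|[|N]] _ f hf.
  (* For [n = 1] only [p = 0] has to be excluded: as [2 * u 1 = 1], one point would have
     [kappa <= x_1 <= 1 / t < kappa]. *)
  exists (1 + kappa^-1); split; first by rewrite ltrDl.
  move=> t tk [|//] x _ x0 xp; have := le_trans x0 xp.
  have -> : 2 * u 1 = 1 :> R by rewrite /u (_ : 1%:Z - 2 = -1) // exprN1; field.
  rewrite powRr1; last by apply: le_trans tk; rewrite addr_ge0 // ltW.
  rewrite leNgt div1r => /negP; case; rewrite -[ltRHS]invrK ltf_pV2 ?posrE //.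
    by apply: lt_le_trans tk; rewrite ltrDr.
  by apply: lt_le_trans tk; rewrite addr_gt0.
set C := ml / (3 + 16 * theta) / (mu * 2 ^+ N.+3).
have C0 : 0 < C.
  have mu0 : 0 < mu by exact: lt_trans hmu.
  have K0 : 0 < 3 + 16 * theta by lra.
  by apply: divr_gt0; [exact: divr_gt0|apply: mulr_gt0 => //; exact: exprn_gt0].
(* The term [kappa^-1] puts the start above the window of the first kink, the last term gives the
   hypothesis [big] of [no_shortcut]. The threshold is [M ^+ 2] because both uses involve the square
   root of [t]. *)
pose M := 1 + kappa^-1 + (1 + 2 * 2 ^+ N.+1 / C).
have P0 : 0 <= 2 * 2 ^+ N.+1 / C 
  by apply: divr_ge0 (ltW C0); apply: mulr_ge0 => //; exact: exprn_ge0.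
have M1 : 1 < M by rewrite /M; lra.
exists (M ^+ 2); split; first by rewrite exprn_egt1.
move=> t tM p x xN x0 xp.
have t1 : 1 < t by apply: lt_le_trans tM; rewrite exprn_egt1.
have Ms : M <= t `^ (1 / 2) by apply: sqrt_large tM; lra.
have big : 2 * 2 ^+ N.+1 < C * t `^ (1 / 2).
  rewrite [ltRHS]mulrC -ltr_pdivrMr //; apply: (lt_le_trans _ Ms); rewrite /M; lra.
(* Vertex [c] is not below the upper edge of the window of kink [c.+1]. One segment cannot cross a
   whole window, and the lower edge of a window is not below the upper edge of the next. *)
have claim c : (c.+1 < 2 ^ N.+2)%N -> (c <= p)%N ->
    t `^ (- kink c.+1 + 1 / 2) <= coord (x c) N.+2.
  elim: c => [|c IH] cN cp.
    apply: le_trans x0.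
    rewrite (_ : - kink 1 + 1 / 2 = - (1 / 2)); last by rewrite /kink /=; lra.
    rewrite powRN -[leRHS]invrK lef_pV2 ?posrE ?pow_gt0 //.
    by apply: (le_trans _ Ms); rewrite /M; lra.
  have cN' : (c.+1 < 2 ^ N.+2)%N by exact: ltnW.
  have seg : segment (x c) (x c.+1) `<=` mult_nbhd_path ml mu (f t) t.
    by move=> y yc; apply: xN; exists c.
  have step := no_shortcut ml0 hmu htheta t1 (hf t t1) _ cN big seg (IH cN' (ltnW cp)).
  apply: ltW; apply: le_lt_trans (step isT).
  by rewrite pow_le //; have := kink_succ R c.+1; lra.
(* With fewer segments, kink [p.+1] is still at most [2 * u n], so the claim leaves the last vertex
   above the target by a factor of at least the square root of [t]. *)
rewrite leqNgt; apply/negP => pN.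
have pN' : (p.+1 < 2 ^ N.+2)%N by move: pN; rewrite ltn_subRL add1n.
have := le_trans (claim p pN' (leqnn p)) xp.
rewrite -powRN [leRHS]mul1r leNgt => /negP; case.
apply: (@lt_le_trans _ _ (t `^ (- (2 * u N.+2) + 1 / 2))); last first.
  by rewrite pow_le //; have := kink_le R pN'; lra.
by rewrite [ltRHS]powD // ltr_pMr ?pow_gt0 // (lt_le_trans M1).
Qed.
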